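(* Every Hamiltonian cubic $3$-pole $(G,H)$ has a proper $4$-cover.
   Context: Graphs may have multiple edges and dangling edges: each edge has either two end vertices (a regular edge) or exactly one end vertex (a dangling edge); no loops. A $3$-pole is a graph in which every vertex has degree $3$ and which has exactly three dangling edges. A Hamiltonian cubic $3$-pole $(G,H)$ is a $3$-pole $G$ together with a distinguished circuit $H$ passing through all vertices of $G$. A chord is an edge of $G$ not in $H$; $Q$ denotes the set of chords (so $E(G)=E(H)\cup Q$). The three dangling edges are called spokes. A perfect matching of $G$ is a set of edges (dangling edges allowed) such that every vertex is incident with exactly one of them. A proper $4$-cover of $(G,H)$ is a set of four perfect matchings $M_1,M_2,M_3,M_4$ of $G$ such that every edge of $G$ lies in at least one $M_i$, $M_4=Q$, and each of the three spokes lies in exactly two of the $M_i$ (is doubly covered). *)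

(* Defs.v *)
From mathcomp Require Import all_boot.

Set Implicit Arguments.
Unset Strict Implicit.
Unset Printing Implicit Defensive.

(* Finite graphs with parallel edges and dangling edges, without loops.  An
   edge has a set of one or two end vertices: a singleton means that it is
   dangling (it cannot mean a loop). *)
Record multipole := Multipole {
  vertex : finType;
  edge : finType;
  ends : edge -> {set vertex};
  ends_card : forall e, (#|ends e| == 1) || (#|ends e| == 2)
}.

Section Multipole.

Variable G : multipole.
Implicit Types (e : edge G) (v : vertex G) (H M : {set edge G}).

Definition dangling e := #|ends e| == 1.
Definition regular e := #|ends e| == 2.

Definition edges_at M v : {set edge G} := [set e in M | v \in ends e].

Definition degree M v := #|edges_at M v|.

Definition cubic3pole :=
  (forall v, degree [set: edge G] v = 3)
  /\ #|[set e : edge G | dangling e]| = 3.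

Definition touches M v := [exists e in M, v \in ends e].

Definition adjacent M : rel (vertex G) :=
  [rel u v | [exists e in M, ends e == [set u; v]]].

(* A circuit is a connected 2-regular subgraph without dangling edges, given
   by its edge set. *)
Definition circuit H :=
  [/\ H != set0,
      forall e, e \in H -> regular e,
      forall v, touches H v -> degree H v = 2
    & forall u v, touches H u -> touches H v -> connect (adjacent H) u v].

Definition hamiltonian_circuit H := circuit H /\ forall v, touches H v.

Definition chords H := ~: H.

Definition perfect_matching M := forall v, degree M v = 1.

End Multipole.

Definition hamiltonian_cubic3pole (G : multipole) (H : {set edge G}) :=
  cubic3pole G /\ hamiltonian_circuit H.

(* The matchings M_1, ..., M_4 are indexed by 'I_4, so M_4 is M ord_max. *)
Definition proper_4cover (G : multipole) (H : {set edge G})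
    (M : 'I_4 -> {set edge G}) :=
  [/\ injective M,
      forall i, perfect_matching (M i),
      forall e, exists i, e \in M i,
      M ord_max = chords H
    & forall e, dangling e -> #|[set i | e \in M i]| = 2].

(* Main.v *)
Require Import Defs.
From mathcomp Require Import all_boot zify.

(* Read the chords along the circuit H: this gives a cyclic word in which the
   three spokes occur once and every other chord twice.  A proper 4-cover is the
   same as a flow with values in Z/2 x Z/2 that is nonzero on H and on the
   spokes, such that between consecutive vertices with a nonzero chord there is
   an even number of vertices whose chord has value zero.  An H-edge of value g
   lies either in M_g only or in the two matchings other than M_g, and the two
   cases alternate at each chord of value zero.

   Existence is by induction on the word.  The spokes cut it into three arcs of
   even total length.  If all three are even, all other chords get value zero.
   Otherwise two arcs are odd.  If there is a circuit alternating between H and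
   the chords and avoiding the spokes, its chords are deleted and get value
   zero.  If there is none, then some odd arc d has exactly one chord t leaving
   it (a form of Kotzig's theorem on unique perfect matchings).  Contract d with
   the spokes around it to one vertex carrying a spoke, and turn t into a spoke;
   a solution of the smaller pole extends by giving every chord of d the value
   of t. *)

Set Implicit Arguments.
Unset Strict Implicit.
Unset Printing Implicit Defensive.

(** * Flows along words *)

Definition color := (bool * bool)%type.
Definition c0 : color := (false, false).
Definition addc (c d : color) : color := (c.1 (+) d.1, c.2 (+) d.2).

(* The matchings containing an edge of H: [(g, true)] stands for {g}, and
   [(g, false)] for the two nonzero colors other than g. *)
Definition state := (color * bool)%type.

(** The rule at a vertex with chord value [c]: each of the first three matchings contains exactly
    one of the two edges of H and the chord. If [c = c0], the two edges have complementary states;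
    otherwise each of them lies in a single matching, and their colors together with [c] are the
    three nonzero colors. *)
Definition step (c : color) (s : state) : option state :=
  if c == c0 then Some (s.1, ~~ s.2)
  else if s.2 && (s.1 != c) then Some (addc s.1 c, true) else None.

Lemma step0 s : step c0 s = Some (s.1, ~~ s.2). Proof. by []. Qed.

Section Words.

Variable T : eqType.
Implicit Types (phi : T -> color) (u v w d r S : seq T) (Z : pred T).

Fixpoint run phi w s : option state :=
  if w is x :: w' then obind (run phi w') (step (phi x) s) else Some s.

Lemma run_cat phi u v s : run phi (u ++ v) s = obind (run phi v) (run phi u s).
Proof. by elim: u s => //= x u IHu s; case: (step _ _) => //= t; exact: IHu. Qed.

Lemma eq_in_run phi psi w : {in w, phi =1 psi} -> run phi w =1 run psi w.
Proof.
elim: w => //= x w IHw eq_w s; rewrite eq_w ?mem_head //.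
by case: (step _ _) => //= t; apply: IHw => y yw; apply: eq_w; rewrite inE yw orbT.
Qed.

Lemma run_neq0 phi w s t : run phi w s = Some t -> s.1 != c0 -> t.1 != c0.
Proof.
elim: w s => /= [|x w IHw] s; first by case=> ->.
case def_s': (step _ _) => [s'|] //= /IHw-IH s_neq0; apply: IH; move: def_s'.
by rewrite /step; case: s s_neq0 => [[[] []] []]; case: (phi x) => [[] []] //= _ [<-].
Qed.

Lemma run_zero phi w g b :
  {in w, forall x, phi x = c0} -> run phi w (g, b) = Some (g, b (+) odd (size w)).
Proof.
elim: w b => /= [|x w IHw] b phi0; first by rewrite addbF.
rewrite phi0 ?mem_head // step0 /= IHw; last first.
  by move=> y yw; rewrite phi0 // inE yw orbT.
by rewrite addNb addbN.
Qed.

Lemma run_constant phi w c g :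
    {in w, forall x, phi x = c} -> c != c0 -> g != c0 -> g != c ->
  run phi w (g, true) = Some (if odd (size w) then addc g c else g, true).
Proof.
move=> phi_c c_neq0; elim: w g phi_c => //= x w IHw g phi_c g_neq0 g_neqc.
rewrite phi_c ?mem_head //= /step (negPf c_neq0) g_neqc /= IHw.
- by case: (odd _); case: g c {IHw phi_c c_neq0 g_neq0 g_neqc} => [[] []] [[] []].
- by move=> y yw; rewrite phi_c // inE yw orbT.
- by case: g c c_neq0 g_neq0 g_neqc {IHw phi_c} => [[] []] [[] []].
by case: g c c_neq0 g_neq0 g_neqc {IHw phi_c} => [[] []] [[] []].
Qed.

(* All maximal runs of letters in [Z] have even length; [b] is true if the run
   ending just before [w] has even length so far. *)
Fixpoint even_runs Z b w : bool :=
  if w is x :: w' then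
    if Z x then even_runs Z (~~ b) w' else b && even_runs Z b w'
  else b.

Lemma even_runs_cat Z u v b :
  even_runs Z b u -> even_runs Z true v -> even_runs Z b (u ++ v).
Proof.
elim: u b => [b /= -> //|x u IHu b] /=; case: (Z x) => [|/andP[-> ]] //; exact: IHu.
Qed.

(** A letter of value zero only flips the second component of the state, so an even run of them
    cancels. The term [~~ b] is the flip still pending when [w] starts inside a run. *)
Lemma run_filter phi psi Z w b g h :
    {in w, forall x, phi x = if Z x then c0 else psi x} -> even_runs Z b w ->
  run phi w (g, h (+) ~~ b) = run psi (filter (predC Z) w) (g, h).
Proof.
elim: w b g h => /= [|x w IHw] b g h phiE; first by move=> ->; rewrite addbF.
have phiE' : {in w, forall x, phi x = if Z x then c0 else psi x}.
  by move=> y yw; apply: phiE; rewrite inE yw orbT.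
rewrite phiE ?mem_head //; case: (Z x) => /=.
  by move/(IHw _ g h phiE') => <-; rewrite -addbN.
case/andP=> /= -> /(IHw _ _ _ phiE')-IH; rewrite /= addbF.
by rewrite /step; do 2?case: ifP => //= _; rewrite -IH addbF.
Qed.

(** The run returns to its initial state because the word is cyclic. Non-spoke letters cancel in the
    sum of all values, so three nonzero spoke values add up to zero and hence are distinct. *)
Definition word_cover S w :=
  exists phi s, [/\ s.1 != c0, run phi w s = Some s & uniq (c0 :: map phi S)].

Lemma word_cover_rot S u v : word_cover S (u ++ v) -> word_cover S (v ++ u).
Proof.
case=> phi [s [s_neq0 run_s S_uniq]]; move: run_s; rewrite run_cat.
case run_u: (run phi u s) => [t|] //= run_v; exists phi, t; split=> //.
  exact: run_neq0 run_u s_neq0.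
by rewrite run_cat run_v.
Qed.

Lemma word_cover_perm S S' w : perm_eq S S' -> word_cover S w -> word_cover S' w.
Proof.
move=> eqS [phi [s [s0 rs Su]]]; exists phi, s; split=> //.
by rewrite -(perm_uniq (s1 := c0 :: map phi S)) // perm_cons perm_map.
Qed.

(* [S] lists the letters that occur only once. *)
Definition pole_word S w :=
  [/\ uniq S, size S = 3
    & forall x, if x \in S then count_mem x w = 1
                else count_mem x w = 0 \/ count_mem x w = 2].

Lemma pole_word_perm S S' w w' :
  perm_eq S S' -> perm_eq w w' -> pole_word S w -> pole_word S' w'.
Proof.
move=> eqS eqw [uS sS cS]; split; first by rewrite -(perm_uniq eqS).
  by rewrite -(perm_size eqS).
move=> x; move: (cS x); rewrite (perm_mem eqS).
by have /permP-> := eqw.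
Qed.

Definition one_exit d :=
  exists2 t, count_mem t d = 1 & forall x, x != t -> count_mem x d != 1.

(** The block from [x] to [y] must act on the state as the single letter [x] does in the contracted
    word. If the ends of the block get the values of [x] and [t] in some order and all of [d] gets
    the value of [t], the sum is right because [d] is odd. *)
Lemma word_cover_contract (x y z t : T) d r :
    pole_word [:: x; y; z] (x :: d ++ y :: r) -> odd (size d) ->
    count_mem t d = 1 -> (forall e, e != t -> count_mem e d != 1) ->
  word_cover [:: x; t; z] (x :: r) -> word_cover [:: x; y; z] (x :: d ++ y :: r).
Proof.
case=> uS _ cS odd_d td d_in [phi [s [s0 rs uphi]]].
(* The spokes of the contracted word have distinct values, so they are distinct letters. *)
have tz : z != t by apply: contraL uphi => /eqP->; rewrite /= !inE eqxx !andbF.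
have [xd yd xr yr] : [/\ x \notin d, y \notin d, x \notin r & y \notin r].
  move: (cS x) (cS y) uS; rewrite !inE !eqxx /= !orbT !count_cat /= !eqxx.
  by rewrite -!has_pred1 !has_count; clear; split; lia.
have [xy zx zy] : [/\ x != y, z != x & z != y].
  by move: uS; rewrite /= !inE !(eq_sym z); case: (x == y); case: (x == z); case: (y == z).
have zd : z \notin d.
  move: (cS z) (d_in z tz); rewrite !inE eqxx /= !orbT !count_cat /=.
  by rewrite -has_pred1 has_count; clear; lia.
pose psi p q e := if e == x then p else if e == y then q else
                  if e \in d then phi t else phi e.
have psi_d p q : {in d, forall e, psi p q e = phi t}.
  move=> e ed; rewrite /psi ed; case: eqVneq ed => [->|_ ed]; first by rewrite (negPf xd).
  by case: eqVneq ed => // ->; rewrite (negPf yd).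
have psi_r p q : run (psi p q) r =1 run phi r.
  apply: eq_in_run => e er; rewrite /psi.
  case: eqVneq er => [->|_ er]; first by rewrite (negPf xr).
  case: eqVneq er => [->|_ er]; first by rewrite (negPf yr).
  (* A letter of [d] other than [t] has both of its occurrences in [d], so only [t] can occur in [r]
     as well, and its value is unchanged. *)
  case: ifP => // ed; congr phi; apply/eqP/contraT; rewrite eq_sym => /d_in.
  have : count_mem e (x :: d ++ y :: r) <= 2 by have := cS e; case: ifP => _; clear; lia.
  move=> + ned; move: ed er ned; rewrite -!has_pred1 !has_count /= count_cat /=; clear; lia.
have psiS p q : map (psi p q) [:: x; y; z] = [:: p; q; phi z].
  by rewrite /= /psi !eqxx (eq_sym y) (negPf xy) (negPf zx) (negPf zy) (negPf zd).
suff [p [q [t1 [h [def_t1 t1_0 t1_t h_def upq]]]]] : exists p q t1 h,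
    [/\ step p s = Some (t1, true), t1 != c0, t1 != phi t,
        obind (step q) (Some (addc t1 (phi t), true)) = Some h /\ step (phi x) s = Some h
      & uniq [:: c0; p; q; phi z]].
  exists (psi p q), s; split=> //; last by rewrite psiS.
  have t0 : phi t != c0.
    by apply: contraL uphi => /eqP t0; rewrite /= t0 !inE eqxx !orbT.
  have [psi_x psi_y _] := psiS p q.
  move: rs; case: h_def => def_h /= ->; rewrite psi_x def_t1 /= run_cat.
  rewrite (run_constant (psi_d p q) t0 t1_0 t1_t) odd_d /= psi_y; move: def_h => /= -> /=.
  by rewrite psi_r.
move: rs; rewrite /=; case def_h: (step (phi x) s) => [h|] //= _.
move: uphi s0 def_h; rewrite /= {psi_r psi_d psiS psi}.
case: s => [g b]; move: (phi x) (phi t) (phi z) => be al ga uphi g0 def_h.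
(* [run_constant] alternates between the two colors other than [al] along [d], so
   the colors [p] and [q] of the spokes at both ends of [d] are [al] and [be] in
   the order that avoids the color of the incoming edge. *)
have [g_al | g_al] := eqVneq g al.
  exists be, al, (addc al be), h; subst g.
  by move: al be ga b uphi g0 def_h => [[] []] [[] []] [[] []] [] //= _ _ [<-].
exists al, be, (addc g al), h.
by move: al be ga g b uphi g0 g_al def_h =>
  [[] []] [[] []] [[] []] [[] []] [] //= _ _ _ [<-].
Qed.

(** Letters of [d] other than [t] lie entirely inside [d] and disappear. The remaining occurrence of
    [t] is in [r], so [t] becomes a spoke in place of [y]. *)
Lemma pole_word_contract x y z t d r :
    pole_word [:: x; y; z] (x :: d ++ y :: r) -> z \notin d ->
    count_mem t d = 1 -> (forall e, e != t -> count_mem e d != 1) ->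
  pole_word [:: x; t; z] (x :: r).
Proof.
case=> uS _ cS zd td d_in.
have [xd yd xr yr] : [/\ x \notin d, y \notin d, x \notin r & y \notin r].
  move: (cS x) (cS y) uS; rewrite !inE !eqxx /= !orbT !count_cat /= !eqxx.
  by rewrite -!has_pred1 !has_count; clear; split; lia.
have t_d : t \in d by rewrite -has_pred1 has_count td.
have [tx ty tz] : [/\ t != x, t != y & t != z].
  by split; apply: contraTneq t_d => ->.
move: (uS); rewrite /= !inE negb_or => /and3P[/andP[xy xz] yz _].
split=> //; first by rewrite /= !inE negb_or eq_sym tx xz tz.
move=> e; move: (cS e) (d_in e); rewrite !inE /= !count_cat /= !(eq_sym e).
have [<-|xe] /= := eqVneq x e; first by clear; lia.
have [<-|te] /= := eqVneq t e; first rewrite !(eq_sym _ t) (negPf ty) (negPf tz) td /=.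
  by clear; lia.
have [<-|ye] /= := eqVneq y e.
  rewrite (eq_sym z) (negPf yz) => _ _; left.
  by move: yr; rewrite -has_pred1 has_count; clear; lia.
have [<-|ze] /= := eqVneq z e.
  by move: zd; rewrite -has_pred1 has_count; clear; lia.
by move=> h /(_ isT); move: h; clear; lia.
Qed.

End Words.

(** * A unique perfect matching has a cut edge *)

(** A matching, flattened to the list of the ends of its edges; disjointness of the edges is left to
    [uniq]. *)
Inductive matched (V : Type) (e : rel V) : seq V -> Prop :=
| Matched0 : matched e [::]
| MatchedS x y s : e x y -> matched e s -> matched e [:: x, y & s].

Lemma matched_cat (V : Type) (e : rel V) s1 s2 :
  matched e s1 -> matched e s2 -> matched e (s1 ++ s2).
Proof. by elim=> //= x y s exy _ IHs /IHs; apply: MatchedS. Qed.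

Lemma matched_map (V W : Type) (p : V -> W) (e : rel W) s :
  matched (relpre p e) s -> matched e (map p s).
Proof. by elim=> /= [|x y {}s exy _]; [apply: Matched0 | apply: MatchedS]. Qed.

Definition toggle i := if odd i then i.-1 else i.+1.

(** The two elements of a pair 2k, 2k+1 add up to 4k+1, which makes [toggle] accessible to linear
    arithmetic. *)
Lemma toggleE i : toggle i = i./2.*2.*2.+1 - i.
Proof. by rewrite /toggle; have := odd_double_half i; case: (odd i) => /=; lia. Qed.

(* The vertices 0, ..., N.*2.-1 form a path that alternates between the perfect
   matching [toggle] and edges of [e]. *)
Section AlternatingPath.

Variables (e : rel nat) (N : nat).
Hypothesis e_path : forall k, k.+1 < N -> e k.*2.+1 k.+1.*2.

Lemma matched_path j k : j <= k < N -> matched e (iota j.*2.+1 (k - j).*2).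
Proof.
case/andP=> /subnKC def_k; rewrite -{1}def_k {def_k}.
move: (k - j) => m; elim: m j => [|m IHm] j ltN.
  exact: Matched0.
rewrite doubleS /=; apply: MatchedS; first by rewrite -doubleS; apply: e_path; lia.
by rewrite -doubleS; apply: IHm; lia.
Qed.

(* The vertices from [k.*2.+1] on form a blossom with base [k.*2.+1]: from the
   base, an alternating path starting in [e] and ending in [toggle] reaches each
   of them.  Edges of [e] are listed in pairs, and extra circuits do no harm. *)
Definition critical k := forall s, k.*2.+1 <= s < N.*2 -> exists t,
  [/\ matched e t, uniq (s :: t),
      forall x, x \in s :: t -> k.*2.+1 <= x < N.*2,
      k.*2.+1 \in s :: t
    & forall x, x \in s :: t -> x != k.*2.+1 -> toggle x \in s :: t].

Definition alternating_circuit t :=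
  [/\ t != [::], matched e t, uniq t, forall x, x \in t -> x < N.*2
    & forall x, x \in t -> toggle x \in t].

Lemma critical_last k : N = k.+1 -> critical k.
Proof.
move=> N_k s s_k; exists [::]; rewrite !inE.
split=> // [|x||x]; rewrite ?inE; first exact: Matched0.
all: lia.
Qed.

(** From the new base, a vertex of the old blossom is reached by following the path up to the old
    base. An odd vertex between the bases is reached forward along the path. An even one is reached
    backward: jump to [s0], cross the old blossom to its base, and descend the path from there. *)
Lemma critical_extend j k s0 :
  j < k < N -> k.*2.+1 <= s0 < N.*2 -> e j.*2.+1 s0 -> critical k -> critical j.
Proof.
move=> /andP[jk kN] s0_k e_s0 crit_k s /andP[js sN].
have toggle_jk x : j.*2.+1 < x < k.*2.+1 ->
    j.*2.+1 < toggle x < k.*2.+1 \/ toggle x = k.*2.+1 by rewrite toggleE; lia.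
have toggle_k : toggle k.*2.+1 = k.*2 by rewrite toggleE; lia.
have [ks | sk] := leqP k.*2.+1 s.
  have [|t [mt ut t_k base_t t_cl]] := crit_k s; first by rewrite ks.
  have mem_t x : (x \in s :: iota j.*2.+1 (k - j).*2 ++ t) =
                 (j.*2.+1 <= x < k.*2.+1) || (x \in s :: t).
    rewrite -cat1s (perm_mem (permEl (perm_catCA _ _ _))) cat1s mem_cat mem_iota.
    by congr (_ && _ || _); lia.
  exists (iota j.*2.+1 (k - j).*2 ++ t); split.
  - by apply: matched_cat => //; apply: matched_path; lia.
  - rewrite -cat1s (perm_uniq (permEl (perm_catCA _ _ _))) cat1s cat_uniq iota_uniq ut andbT.
    by apply/hasPn => x /t_k; rewrite mem_iota; lia.
  - by move=> x; rewrite mem_t => /orP[|/t_k]; lia.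
  - by rewrite mem_t; lia.
  move=> x; rewrite !mem_t => /orP[x_jk | x_t] x_j.
    by have [| |->] := toggle_jk x; rewrite ?base_t ?orbT //; lia.
  have [->|x_k] := eqVneq x k.*2.+1; first by rewrite toggle_k; lia.
  by rewrite t_cl ?orbT.
have [[i def_s] | [i def_s]] : (exists i, s = i.*2.+1) \/ (exists i, s = i.*2).
  have := odd_double_half s; case: (odd s); [left | right]; exists s./2; lia.
- exists (iota j.*2.+1 (i - j).*2).
  have mem_t x : (x \in s :: iota j.*2.+1 (i - j).*2) = (j.*2.+1 <= x < i.*2.+2).
    by rewrite inE mem_iota; lia.
  split; first by apply: matched_path; lia.
  - by rewrite /= mem_iota iota_uniq; lia.
  - by move=> x; rewrite mem_t; lia.
  - by rewrite mem_t; lia.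
  by move=> x; rewrite !mem_t toggleE; lia.
have [t [mt ut t_k base_t t_cl]] := crit_k s0 s0_k.
pose c := iota i.*2.+1 (k - i).*2.
have mem_t x : (x \in s :: j.*2.+1 :: s0 :: c ++ t) =
    [|| x == j.*2.+1, i.*2 <= x < k.*2.+1 | x \in s0 :: t].
  rewrite !inE mem_cat mem_iota.
  by case: (x \in t); case: (x == s0); rewrite ?orbT //=; lia.
exists (j.*2.+1 :: s0 :: c ++ t); split.
- by apply: MatchedS => //; apply: matched_cat => //; apply: matched_path; lia.
- have -> : uniq (s :: j.*2.+1 :: s0 :: c ++ t) =
            uniq ((s :: j.*2.+1 :: c) ++ (s0 :: t)).
    by apply: perm_uniq; rewrite !perm_cons -cat1s perm_catCA.
  rewrite cat_uniq ut andbT; apply/andP; split.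
    by rewrite /= inE !mem_iota iota_uniq; lia.
  by apply/hasPn => x /t_k; rewrite !inE mem_iota; lia.
- by move=> x; rewrite mem_t => /or3P[||/t_k]; lia.
- by rewrite mem_t eqxx.
move=> x; rewrite !mem_t => /or3P[/eqP->|x_ik|x_t] x_j; first by rewrite eqxx in x_j.
  have [] : i.*2 <= toggle x < k.*2.+1 \/ toggle x = k.*2.+1 by rewrite toggleE; lia.
    by move=> h; apply/or3P; constructor 2; lia.
  by move=> ->; rewrite base_t !orbT.
have [->|x_k] := eqVneq x k.*2.+1; first by rewrite toggle_k; lia.
by rewrite t_cl ?orbT.
Qed.

(** The circuit goes from [j.*2] to [s0], through the blossom to its base, and back down the path to
    [j.*2.+1], which [toggle] joins to [j.*2]. *)
Lemma critical_circuit j k s0 :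
    j <= k < N -> k.*2.+1 <= s0 < N.*2 -> e j.*2 s0 -> critical k ->
  exists t, alternating_circuit t.
Proof.
move=> /andP[jk kN] s0_k e_s0 /(_ _ s0_k)[t [mt ut t_k base_t t_cl]].
pose c := iota j.*2.+1 (k - j).*2.
have mem_t x : (x \in j.*2 :: s0 :: c ++ t) = (j.*2 <= x < k.*2.+1) || (x \in s0 :: t).
  rewrite !inE mem_cat mem_iota.
  by case: (x \in t); case: (x == s0); rewrite ?orbT //=; lia.
exists (j.*2 :: s0 :: c ++ t); split=> //.
- by apply: MatchedS => //; apply: matched_cat => //; apply: matched_path; lia.
- have -> : uniq (j.*2 :: s0 :: c ++ t) = uniq ((j.*2 :: c) ++ (s0 :: t)).
    by apply: perm_uniq; rewrite perm_cons -cat1s perm_catCA.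
  rewrite cat_uniq ut andbT; apply/andP; split.
    by rewrite /= !mem_iota iota_uniq; lia.
  by apply/hasPn => x /t_k; rewrite !inE mem_iota; lia.
- by move=> x; rewrite mem_t => /orP[|/t_k]; lia.
move=> x; rewrite !mem_t => /orP[x_jk|x_t].
  have [] : j.*2 <= toggle x < k.*2.+1 \/ toggle x = k.*2.+1 by rewrite toggleE; lia.
    by move=> h; apply/orP; left; lia.
  by move=> ->; rewrite base_t !orbT.
have [->|x_k] := eqVneq x k.*2.+1; last by rewrite t_cl ?orbT.
have -> : toggle k.*2.+1 = k.*2 by rewrite toggleE; lia.
by lia.
Qed.

(** The blossom grows downward from the last vertex. An edge of [e] entering it from below at an odd
    vertex enlarges it, and one at an even vertex closes a circuit. With no such edge, the matching
    edge from [k.*2] to [k.*2.+1] is the only one across the cut. *)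
Lemma circuit_or_cut : 0 < N ->
  (exists t, alternating_circuit t) \/
  exists2 k, k < N & forall x y, x < k.*2.+1 -> k.*2.+1 <= y < N.*2 -> ~~ e x y.
Proof.
move=> N_gt0; have: critical N.-1 by apply: critical_last; lia.
have: N.-1 < N by lia.
elim/ltn_ind: N.-1 => k IHk kN crit_k.
have [/hasP[x] | no_edge] := boolP (has (fun x =>
    has (e x) (iota k.*2.+1 (N.*2 - k.*2.+1))) (iota 0 k.*2.+1)); last first.
  right; exists k => // x y xk yk; apply: contra no_edge => exy.
  by apply/hasP; exists x; [|apply/hasP; exists y]; rewrite ?mem_iota //; lia.
rewrite mem_iota => xk /hasP[y]; rewrite mem_iota => yk exy.
have /orP[/eqP x_odd | /eqP x_even] : (x == x./2.*2.+1) || (x == x./2.*2) by lia.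
  apply: (IHk x./2); [lia | lia |].
  by apply: (@critical_extend _ k y) => //; [lia | lia | rewrite -x_odd].
left; apply: (@critical_circuit x./2 k y) => //; [lia | lia | by rewrite -x_even].
Qed.

End AlternatingPath.

(** * Alternating orbits of two involutions *)

Section Fibre.

Variables (V : finType) (I : eqType) (g : V -> I).
Hypothesis card_fibre : forall x, #|[set y | g y == g x]| = 2.

(** The default is never reached, since every fibre has a second element. *)
Definition partner x := odflt x [pick y | (y != x) && (g y == g x)].

Lemma partnerP x : (partner x != x) /\ g (partner x) = g x.
Proof.
rewrite /partner; case: pickP => [y /andP[yx /eqP gy] | no_y] //=.
have := card_fibre x; rewrite (cardsD1 x) inE eqxx.
suff ->: [set y | g y == g x] :\ x = set0 by rewrite cards0.
by apply/setP=> y; rewrite !inE no_y.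
Qed.

Lemma partner_neq x : partner x != x. Proof. by case: (partnerP x). Qed.
Lemma partner_fibre x : g (partner x) = g x. Proof. by case: (partnerP x). Qed.

Lemma fibreE x : [set y | g y == g x] = [set x; partner x].
Proof.
apply/esym/eqP; rewrite eqEcard card_fibre cards2 eq_sym partner_neq andbT.
by apply/subsetP => y; rewrite !inE => /pred2P[] ->; rewrite ?partner_fibre.
Qed.

Lemma fibre_partner x y : g y = g x -> y = x \/ y = partner x.
Proof.
move=> gyx; apply/pred2P; have := in_set2 y x (partner x).
by rewrite -fibreE inE gyx eqxx.
Qed.

Lemma partnerK : involutive partner.
Proof.
move=> x; have [] // := @fibre_partner x (partner (partner x)).
  by rewrite !partner_fibre.
by move=> ppx; have := partner_neq (partner x); rewrite {1}ppx eqxx.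
Qed.

End Fibre.

Section TwoInvolutions.

Variables (V : finType) (s t : V -> V).
Hypotheses (sK : involutive s) (tK : involutive t).
Hypotheses (s_neq : forall x, s x != x) (t_neq : forall x, t x != x).

Lemma comp_involutions_inj : injective (s \o t).
Proof. by apply: inj_comp; [apply: inv_inj sK | apply: inv_inj tK]. Qed.

(** Cancelling one involution at each end turns an equality for exponent k+2 at [x] into one for k
    at [s (t x)]. The descent ends in a fixed point of [t] or of [s]. *)
Lemma iter_comp_neq k x : iter k (s \o t) x != t x.
Proof.
elim/ltn_ind: k x => -[|[|k]] IHk x; first by rewrite eq_sym t_neq.
  exact: s_neq.
have := IHk k (leqnSn _) (s (t x)); apply: contra => /eqP def_tx; apply/eqP.
apply: comp_involutions_inj.
by rewrite -iterS -[s (t x)]/((s \o t) x) -iterSr def_tx /= tK sK.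
Qed.

Lemma orbit_comp_disjoint x y : y \in orbit (s \o t) x -> t y \notin orbit (s \o t) x.
Proof.
rewrite -!fconnect_orbit => xy; apply/negP => xty.
have /iter_findex/eqP : fconnect (s \o t) y (t y).
  by rewrite -(same_connect (fconnect_sym comp_involutions_inj) xy).
by rewrite (negPf (iter_comp_neq _ _)).
Qed.

(** The orbit of [x] under both involutions: a cycle alternating between [s] and [t], made of two
    orbits of [s \o t] that [t] interchanges. *)
Definition alternating_component x :=
  [pred y | (y \in orbit (s \o t) x) || (t y \in orbit (s \o t) x)].

Lemma alternating_component_t x y :
  (t y \in alternating_component x) = (y \in alternating_component x).
Proof. by rewrite !inE tK orbC. Qed.

Lemma orbit_comp x y : (s (t y) \in orbit (s \o t) x) = (y \in orbit (s \o t) x).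
Proof.
rewrite -!fconnect_orbit -[s (t y)]/((s \o t) y).
by rewrite -(same_fconnect1_r comp_involutions_inj).
Qed.

Lemma alternating_component_s x y :
  (s y \in alternating_component x) = (y \in alternating_component x).
Proof. by rewrite !inE -(orbit_comp x (t (s y))) tK sK -{1}(tK y) orbit_comp orbC. Qed.

Variable x : V.
Hypothesis (component_full : forall y, y \in alternating_component x).

Lemma orbit_comp_t y : (t y \in orbit (s \o t) x) = (y \notin orbit (s \o t) x).
Proof.
have := component_full y; rewrite inE.
have [y_in _ | _ /= ->] // := boolP (y \in _).
by rewrite (negPf (orbit_comp_disjoint y_in)).
Qed.

Lemma orbit_comp_s y : (s y \in orbit (s \o t) x) = (y \notin orbit (s \o t) x).
Proof. by rewrite -{1}(tK y) orbit_comp orbit_comp_t. Qed.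

End TwoInvolutions.

(** * Even runs of positions in an interval *)

Section EvenRuns.

Implicit Types (P : pred nat).

Lemma even_runs_map (U T : eqType) (f : U -> T) Z b s :
  even_runs Z b (map f s) = even_runs (preim f Z) b s.
Proof. by elim: s b => //= x s IHs b; rewrite !IHs. Qed.

Lemma eq_in_even_runs (T : eqType) (Z Z' : pred T) b s :
  {in s, Z =1 Z'} -> even_runs Z b s = even_runs Z' b s.
Proof.
elim: s b => //= x s IHs b eqZ; rewrite eqZ ?mem_head // !IHs // => y ys.
all: by apply: eqZ; rewrite inE ys orbT.
Qed.

Lemma even_runs_cat2 (T : eqType) (Z : pred T) b s1 x y s2 :
    ~~ Z x -> ~~ Z y ->
  even_runs Z b (s1 ++ [:: x, y & s2]) = even_runs Z b s1 && even_runs Z true s2.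
Proof.
move=> Zx Zy; elim: s1 b => /= [|z s1 IHs] b.
  by rewrite (negPf Zx) (negPf Zy); case: b.
by rewrite !IHs; case: (Z z) => //; rewrite andbA.
Qed.

(** Two adjacent new positions join the even runs on either side into one even run. The conditions
    on [i.+1] keep the pair from straddling an end of the interval. *)
Lemma even_runs_add P P' i lo len :
    ~~ P i -> ~~ P i.+1 -> P' =1 [pred x | [|| x == i, x == i.+1 | P x]] ->
    i.+1 != lo -> i.+1 != lo + len ->
  even_runs P true (iota lo len) -> even_runs P' true (iota lo len).
Proof.
move=> Pi Pi1 P'E i_lo i_len.
have P'i : P' i by rewrite P'E /= eqxx.
have P'i1 : P' i.+1 by rewrite P'E /= eqxx orbT.
have P'P s : {in s, forall x, x != i /\ x != i.+1} ->
    even_runs P' true s = even_runs P true s.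
  move=> si; apply: eq_in_even_runs => x /si[xi xi1].
  by rewrite P'E /= (negPf xi) (negPf xi1).
have [i_in | i_out] := boolP (lo <= i < lo + len); last first.
  by rewrite P'P // => x; rewrite mem_iota; lia.
have ->: iota lo len = iota lo (i - lo) ++ [:: i, i.+1 & iota i.+2 (lo + len - i.+2)].
  have -> : len = (i - lo) + (2 + (lo + len - i.+2)) by lia.
  by rewrite iotaD /=; congr (_ ++ [:: _, _ & iota _ _]); lia.
rewrite even_runs_cat2 // => /andP[Plo Phi]; apply: even_runs_cat.
  by rewrite P'P // => x; rewrite mem_iota; lia.
rewrite /= P'i P'i1 /=.
by rewrite P'P // => x; rewrite mem_iota; lia.
Qed.

(** Each edge of the matching adds two adjacent positions, both inside or both outside the
    interval. *)
Lemma matched_even_runs (e : rel nat) lo len s :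
    (forall i j, e i j -> exists k, [/\ perm_eq [:: i; j] [:: k; k.+1],
                                       k.+1 != lo & k.+1 != lo + len]) ->
    matched e s -> uniq s ->
  even_runs (mem s) true (iota lo len).
Proof.
move=> eP; elim=> {s} [|x y s /eP[k [xyk k_lo k_len]] _ IHs].
  by move=> _; elim: len {eP} lo => //= n IHn lo; rewrite IHn.
rewrite -[x :: y :: s]/([:: x; y] ++ s) => uxys.
have: uniq ([:: k; k.+1] ++ s) by rewrite -(perm_uniq (perm_cat xyk (perm_refl s))).
rewrite /= !inE negb_or => /and3P[/andP[_ ks] k1s us].
apply: (even_runs_add (P := mem s) (i := k)) => //; last exact: IHs.
by move=> z; have := perm_mem xyk z; rewrite /= !inE !orbA => ->.
Qed.

End EvenRuns.

(** * Arcs with a single exit *)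

Lemma card_positions (T : eqType) (w : seq T) lo len x : lo + len <= size w ->
  #|[set i : 'I_(size w) | (lo <= i < lo + len) && (tnth (in_tuple w) i == x)]|
    = count_mem x (take len (drop lo w)).
Proof.
move=> lo_len; rewrite -sum1_card.
transitivity (\sum_(i < size w | (lo <= i < lo + len) && (nth x w i == x)) 1).
  by apply: eq_bigl => i; rewrite inE (tnth_nth x).
rewrite -(big_mkord (fun i => (lo <= i < lo + len) && (nth x w i == x)) (fun=> 1)).
rewrite sum1_count /index_iota subn0 -(map_nth_iota x); last by lia.
have -> : size w = lo + (len + (size w - (lo + len))) by lia.
rewrite !iotaD !count_cat add0n count_map.
rewrite (@eq_in_count _ _ pred0 (iota 0 lo)); last by move=> i; rewrite mem_iota /=; lia.
rewrite (@eq_in_count _ _ pred0 (iota (lo + len) _)); last first.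
  by move=> i; rewrite mem_iota /=; lia.
rewrite !count_pred0 add0n addn0; apply: eq_in_count => i; rewrite mem_iota /=.
by move=> ->.
Qed.

Lemma matched_closed (V : finType) (e : rel V) (f : V -> V) (A : {set V}) :
    involutive f -> (forall x, f x != x) ->
    {in A, forall x, f x \in A} -> {in A, forall x, e x (f x)} ->
  exists s, [/\ matched e s, uniq s & s =i A].
Proof.
move=> fK f_neq; have [k] := ubnP #|A|; elim: k A => // k IHk A ltAk fA eA.
have [->|[x xA]] := set_0Vmem A.
  by exists [::]; split=> // [|x]; [apply: Matched0 | rewrite !inE].
have [|y|y|s [ms us def_s]] := IHk (A :\ x :\ f x).
- rewrite (cardsD1 x) xA (cardsD1 (f x)) !inE f_neq fA // in ltAk; lia.
- rewrite !inE => /and3P[yfx yx yA]; rewrite (inj_eq (inv_inj fK)) yx.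
  by rewrite -(inj_eq (inv_inj fK)) fK yfx fA.
- by rewrite !inE => /and3P[_ _ yA]; apply: eA.
exists [:: x, f x & s]; split; first by apply: MatchedS; rewrite ?eA.
  by rewrite /= us !(inE, def_s) !eqxx /= !andbF andbT orbF eq_sym f_neq.
move=> y; rewrite !(inE, def_s); case: eqVneq => [-> //|_] /=.
by case: eqVneq => [-> /=|]; rewrite ?fA.
Qed.

Section Exit.

Variables (T : eqType) (a b c : seq T).

Let w := a ++ b ++ c.

Hypotheses (even_a : ~~ odd (size a)) (odd_b : odd (size b)) (odd_c : odd (size c)).
Hypothesis count_w : forall x, count_mem x w = 0 \/ count_mem x w = 2.

Let n := size w.
Let letter (i : 'I_n) := tnth (in_tuple w) i.

Let size_w : n = size a + size b + size c.
Proof. by rewrite /n /w !size_cat addnA. Qed.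

Let even_n : ~~ odd n.
Proof. by rewrite size_w !oddD (negPf even_a) odd_b odd_c. Qed.

Let card_letter i : #|[set j | letter j == letter i]| = 2.
Proof.
have := @card_positions _ w 0 n (letter i) (leqnn _).
rewrite drop0 take_size; set A := [set _ | _]; set B := [set _ | _].
have -> : A = B by apply/setP => j; rewrite !inE leq0n ltn_ord.
have [-> | ->] // := count_w (letter i) => /eqP; rewrite cards_eq0 => /eqP B0.
by have := in_set0 i; rewrite -B0 inE eqxx leq0n add0n ltn_ord.
Qed.

Let m := partner letter.
Let mK : involutive m := partnerK card_letter.
Let m_neq x : m x != x := partner_neq card_letter x.

Let toggle_lt (i : 'I_n) : toggle i < n.
Proof. by rewrite toggleE; have := ltn_ord i; have := even_n; lia. Qed.

(* [f] follows edges of the arcs, except that it pairs the last position [u] of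
   [b] with the first position of [c]. *)
Let f (i : 'I_n) : 'I_n := Ordinal (toggle_lt i).

Let fK : involutive f.
Proof. by move=> i; apply: val_inj; rewrite /= !toggleE; lia. Qed.

Let f_neq i : f i != i.
Proof. by rewrite -val_eqE /= toggleE; lia. Qed.

(** Successive positions within one arc: the excluded values of [i] are the positions where [b] and
    [c] begin. *)
Let adj (i j : nat) :=
  [&& i < n, i != size a, i != size a + size b & i == j.+1].
Let e := [rel i j : 'I_n | adj i j || adj j i].

Let u_lt : (size a + size b).-1 < n. Proof. by move: odd_c; rewrite size_w; lia. Qed.
Let u : 'I_n := Ordinal u_lt.

Let e_f i : i != u -> i != f u -> e i (f i).
Proof.
rewrite -!val_eqE /= /adj ltn_ord toggle_lt !toggleE; move: even_a odd_b.
by move: (nat_of_ord i) (size a) (size b); clear; lia.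
Qed.

(** Closure under [m] means that the positions in [s] are all occurrences of a set [Z] of letters.
    The edges of [e] never leave an arc, so these positions form even runs in each arc. *)
Lemma circuit_even_runs (s : seq 'I_n) :
    s != [::] -> matched e s -> uniq s -> {in s, forall i, m i \in s} ->
  exists Z, [/\ has Z w, even_runs Z true a, even_runs Z true b & even_runs Z true c].
Proof.
move=> s0 ms us s_m; pose Z x := x \in map letter s.
have Zs i : Z (letter i) = (i \in s).
  apply/mapP/idP => [[j js] | is_]; last by exists i.
  by case/(fibre_partner card_letter) => -> //; apply: s_m.
have Z_block lo len : lo + len <= n ->
    (forall i, adj i.+1 i -> i.+1 != lo /\ i.+1 != lo + len) ->
    even_runs Z true (take len (drop lo w)).
  move=> lo_len blk; case: s s0 @Z Zs ms us s_m => // i0 s _ Z Zs ms us _.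
  rewrite -(map_nth_iota (letter i0)) ?even_runs_map; last by rewrite -/n; lia.
  rewrite (@eq_in_even_runs _ _ (mem (map val (i0 :: s)))); last first.
    move=> i; rewrite mem_iota => i_blk; have i_n : i < n by lia.
    rewrite [preim _ _ _]/= (_ : nth _ w i = letter (Ordinal i_n)); last first.
      exact/esym/tnth_nth.
    by rewrite Zs -(mem_map val_inj).
  apply: (@matched_even_runs (fun i j => adj i j || adj j i)).
  - move=> i j /orP[] aij.
      exists j; have def_i : i = j.+1 by apply/eqP; case/and4P: aij.
      have [] := blk j; first by rewrite -def_i.
      by split=> //; rewrite def_i (perm_catC [:: _]).
    exists i; have def_j : j = i.+1 by apply/eqP; case/and4P: aij.
    by have [] := blk i; [rewrite -def_j | split; rewrite ?def_j].
  - exact: matched_map.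
  by rewrite map_inj_uniq //; apply: val_inj.
exists Z; split.
- case: s s0 @Z Zs {ms us s_m Z_block} => // i s _ Z Zs.
  by apply/hasP; exists (letter i); rewrite ?Zs ?mem_head ?mem_tnth.
- have := Z_block 0 (size a); rewrite drop0 take_size_cat //.
  by apply; [rewrite size_w; lia | rewrite /adj => i; lia].
- have := Z_block (size a) (size b); rewrite drop_size_cat // take_size_cat //.
  by apply; [rewrite size_w; lia | rewrite /adj => i; lia].
have := Z_block (size a + size b) (size c).
rewrite /w catA drop_size_cat ?size_cat // take_size; apply; first by rewrite size_w.
by rewrite /adj size_w => i; lia.
Qed.

(** The number of occurrences of a letter in the block is the number of ends of its chord in [X], so
    a letter occurs once exactly when its chord crosses the boundary of [X]. *)
Lemma block_one_exit (X : pred 'I_n) lo len x0 :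
    lo + len <= n -> (forall i : 'I_n, X i = (lo <= i < lo + len)) ->
    X x0 != X (m x0) -> (forall i, X i != X (m i) -> i = x0 \/ m i = x0) ->
  one_exit (take len (drop lo w)).
Proof.
move=> lo_len XE x0_exit exit_x0.
have countE i : count_mem (letter i) (take len (drop lo w)) = X i + X (m i).
  rewrite -card_positions // -sum1_card.
  transitivity (\sum_(j in [set j | letter j == letter i]) (X j : nat)).
    rewrite big_mkcond /= [RHS]big_mkcond /=; apply: eq_bigr => j _.
    by rewrite !inE -/(letter j) -XE; case: (X j); case: eqP.
  by rewrite fibreE // big_setU1 ?big_set1 // inE eq_sym m_neq.
exists (letter x0).
  by rewrite countE; case: (X x0) x0_exit; case: (X (m x0)).
move=> x x_x0; have [/seq_tnthP | xw] := boolP (x \in w); last first.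
  have /eqP := count_memPn xw; rewrite -{1}(cat_take_drop lo w) count_cat.
  by rewrite -{1}(cat_take_drop len (drop lo w)) count_cat; lia.
case=> i def_x; rewrite def_x -/(letter i) countE.
apply: contra x_x0 => exit_i; apply/eqP; rewrite def_x -/(letter i).
have: X i != X (m i) by case: (X i) (X (m i)) exit_i => [] [].
by case/exit_x0 => <-; rewrite // /letter /m partner_fibre.
Qed.

Lemma even_runs_or_one_exit :
  (exists Z, [/\ has Z w, even_runs Z true a, even_runs Z true b & even_runs Z true c])
  \/ one_exit b \/ one_exit c.
Proof.
pose pi := f \o m; pose N := order pi u.
have iter_inj k l : k < N -> l < N -> iter k pi u = iter l pi u -> k = l.
  by move=> kN lN /(congr1 (findex pi u)); rewrite !findex_iter.
have iter_m k l : iter k pi u != m (iter l pi u).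
  apply/eqP => k_l; have := @orbit_comp_disjoint _ f m fK mK f_neq m_neq u (iter l pi u).
  by rewrite -k_l -!fconnect_orbit !fconnect_iter => /(_ isT).
(* [pos] walks from [u] alternately along [m] and [f]; on indices, [m] becomes [toggle]. *)
pose pos k := if odd k then m (iter k./2 pi u) else iter k./2 pi u.
have pos_even k : pos k.*2 = iter k pi u by rewrite /pos odd_double doubleK.
have pos_odd k : pos k.*2.+1 = m (iter k pi u).
  by rewrite /pos /= odd_double /= uphalf_double.
have pos_toggle k : pos (toggle k) = m (pos k).
  have := odd_double_half k; case: (odd k) => /= <-.
    by rewrite pos_odd mK -pos_even; congr pos; rewrite toggleE; lia.
  by rewrite add0n pos_even -pos_odd; congr pos; rewrite toggleE; lia.
have pos_inj k l : k < N.*2 -> l < N.*2 -> pos k = pos l -> k = l.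
  have := odd_double_half k; have := odd_double_half l.
  case: (odd k); case: (odd l) => /= <- <-; rewrite ?add0n ?add1n ?pos_odd ?pos_even => kN lN.
  - by move=> /(inv_inj mK)/iter_inj->; lia.
  - by move/esym/eqP; rewrite (negPf (iter_m _ _)).
  - by move/eqP; rewrite (negPf (iter_m _ _)).
  - by move=> /iter_inj->; lia.
(* Outside the component of [u], all pairs of [f] are arc edges, so the pairs of [m] and [f] there
   already form alternating circuits. *)
have [/existsP[i1 i1_out] | ] :=
    boolP [exists i, i \notin alternating_component f m u].
  left; pose A := [set i | i \notin alternating_component f m u].
  have u_in : u \in alternating_component f m u by rewrite inE in_orbit.
  have [|i|s [ms us sA]] := @matched_closed _ e f A fK f_neq.
  - by move=> i; rewrite !in_set alternating_component_s.
  - rewrite in_set => iA; apply: e_f; apply: contraNneq iA => -> //.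
    by rewrite alternating_component_s.
  apply: (circuit_even_runs _ ms us) => [|i]; last first.
    by rewrite !sA !in_set alternating_component_t.
  by have : i1 \in s; [rewrite sA in_set | case: (s)].
rewrite negb_exists => /forallP all_in.
have posP i : exists2 k, k < N.*2 & pos k = i.
  have := all_in i; rewrite negbK inE -!fconnect_orbit => /orP[] iu.
    exists (findex pi u i).*2; first by rewrite ltn_double findex_max.
    by rewrite pos_even iter_findex.
  exists (findex pi u (m i)).*2.+1; first by rewrite -doubleS leq_double findex_max.
  by rewrite pos_odd iter_findex // mK.
(* Now the walk visits every position, from [u] to [f u], and the one pair of [f] that may fail to
   be an arc edge is the pair of its two ends. *)
have [k kN | | [t [t0 mt ut tN t_toggle]] | [k kN cut]] :=
    @circuit_or_cut (relpre pos e) N.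
- rewrite /= pos_odd pos_even iterS; apply: e_f.
    by rewrite eq_sym (iter_m 0).
  apply/eqP => /(congr1 f); rewrite fK -[f (m _)]/(pi _) -iterS.
  by move/(@iter_inj k.+1 0 kN (ltn_trans (ltn0Sn k) kN)).
- exact: order_gt0.
- left; apply: (@circuit_even_runs (map pos t)).
  + by case: (t) t0.
  + exact: matched_map.
  + by rewrite map_inj_in_uniq // => i j /tN iN /tN jN; apply: pos_inj.
  by move=> _ /mapP[i it ->]; rewrite -pos_toggle map_f ?t_toggle.
(* [X] is the side of the cut that contains [u]. No arc edge crosses the cut, so [X] is constant on
   each arc; it holds on [b] through [u] and fails on [c] through [f u]. *)
pose X i := has (fun x => pos x == i :> nat) (iota 0 k.*2.+1).
have Xpos x : x < N.*2 -> X (pos x) = (x < k.*2.+1).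
  move=> xN; apply/hasP/idP => [[y] | xk].
    by rewrite mem_iota => yk /eqP/val_inj/pos_inj<-; lia.
  by exists x; rewrite ?mem_iota //=; lia.
have X_e i j : e i j -> X i = X j.
  have [x xN <-] := posP i; have [y yN <-] := posP j; rewrite !Xpos // => exy.
  apply/idP/idP => x_low; apply/contraT => y_high.
    have y_in : k.*2.+1 <= y < N.*2 by rewrite leqNgt y_high.
    by case/negP: (cut x y x_low y_in).
  have x_in : k.*2.+1 <= x < N.*2 by rewrite leqNgt y_high.
  by case/negP: (cut y x x_low x_in); move: exy; rewrite /= orbC.
have X_step i : i.+1 < n -> i.+1 != size a -> i.+1 != size a + size b -> X i.+1 = X i.
  move=> i_n i_a i_ab; have i_n' := ltnW i_n.
  have := X_e (Ordinal i_n) (Ordinal i_n') => -> //.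
  by rewrite /= /adj i_n i_a i_ab eqxx.
have X_const lo hi i : lo <= i < hi -> hi <= n ->
    (forall i, lo < i < hi -> i != size a /\ i != size a + size b) -> X i = X lo.
  case/andP=> lo_i i_hi hi_n no_break; elim: i lo_i i_hi => [|i IHi] lo_i i_hi.
    by congr X; lia.
  have [<- // | lo_neq] := eqVneq lo i.+1.
  have [|i_a i_ab] := no_break i.+1; first by lia.
  by rewrite X_step ?IHi //; lia.
have X_u : X u by rewrite -[u]/(pos 0) Xpos // double_gt0 order_gt0.
(* The walk closes up after [N] rounds, so [f u] is its last position and lies beyond the cut. *)
have X_fu : X (f u) = false.
  have f_last : f u = pos N.-1.*2.+1.
    apply: (inv_inj fK); rewrite fK pos_odd -[f _]/(pi (iter _ pi u)) -iterS.
    rewrite prednK ?order_gt0 // iter_order //.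
    exact: comp_involutions_inj fK mK.
  by rewrite f_last Xpos; have := order_gt0 pi u; rewrite -/N; lia.
have val_fu : f u = size a + size b :> nat.
  by rewrite /= toggleE; move: even_a odd_b; lia.
have X_b i : size a <= i < size a + size b -> X i.
  move=> i_b; rewrite (X_const (size a) (size a + size b)) ?size_w //; [|lia|lia].
  rewrite -(X_const (size a) (size a + size b) u) ?size_w //=; [|lia|lia].
  by move: odd_b; lia.
have X_c i : size a + size b <= i < n -> X i = false.
  by move=> i_c; rewrite (X_const (size a + size b) n) -?val_fu //; lia.
have X_a i : i < size a -> X i = X 0.
  by move=> i_a; rewrite (X_const 0 (size a)) ?size_w //; lia.
pose x0 := pos k.*2.
have x0_exit : X x0 != X (m x0).
  by rewrite -pos_toggle toggleE !Xpos; lia.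
have exit_x0 (i : 'I_n) : X i != X (m i) -> i = x0 \/ m i = x0.
  have [x xN <-] := posP i; rewrite -pos_toggle toggleE !Xpos; [|lia|lia].
  move=> x_exit; have [-> | ->]: x = k.*2 \/ x = k.*2.+1 by lia.
    by left.
  by right; congr pos; lia.
(* The arc [a] joins one of the two sides, and the other side is exactly [c] or exactly [b]. An
   empty [a] is counted with the second case. *)
right; have [X0 | X0] := boolP (X 0 && (0 < size a)); [right | left].
  have -> : c = take (size c) (drop (size a + size b) w).
    by rewrite /w catA drop_size_cat ?size_cat ?take_size.
  apply: (@block_one_exit (fun i => ~~ X i) _ _ x0); first by rewrite size_w.
  - move=> i; rewrite -size_w ltn_ord andbT; case: leqP => [i_c | i_ab].
      by rewrite X_c // i_c ltn_ord.
    have [i_a | a_i] := ltnP i (size a); first by rewrite X_a //; case/andP: X0 => ->.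
    by rewrite X_b ?a_i.
  - by rewrite (inj_eq negb_inj).
  by move=> i; rewrite (inj_eq negb_inj); apply: exit_x0.
have -> : b = take (size b) (drop (size a) w) by rewrite /w drop_size_cat ?take_size_cat.
apply: (@block_one_exit X _ _ x0) => //; first by rewrite size_w leq_addr.
move=> i; have [i_a | a_i] := ltnP i (size a).
  by rewrite X_a //; move: X0; rewrite (leq_ltn_trans _ i_a) // andbT => /negPf.
have [i_ab | i_ab] := ltnP i (size a + size b); first by rewrite X_b ?a_i.
by rewrite X_c ?i_ab ?ltn_ord ?andbF.
Qed.

End Exit.

(** * Covers of words *)

Section WordTheorem.

Variable T : eqType.
Implicit Types (a b c d w S : seq T) (Z : pred T).

Lemma even_size_of_counts w :
  (forall x, ~~ odd (count_mem x w)) -> ~~ odd (size w).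
Proof.
have [k] := ubnP (size w); elim: k w => // k IHk [//|x w] /= ltwk even_w.
have xw : x \in w.
  by move: (even_w x); rewrite -has_pred1 has_count eqxx; case: (count _ _).
have w_perm := perm_to_rem xw; rewrite (perm_size w_perm) /= negbK; apply: IHk.
  by move: ltwk; rewrite (perm_size w_perm) /=; lia.
move=> y; move: (even_w y); have /permP-> := w_perm.
by rewrite /= !oddD addbA addbb.
Qed.

Lemma word_cover_filter Z S w :
    {in S, forall x, ~~ Z x} -> even_runs Z true w ->
  word_cover S (filter (predC Z) w) -> word_cover S w.
Proof.
move=> SZ even_w [psi [[g h] [g0 run_psi uS]]].
pose phi x := if Z x then c0 else psi x; exists phi, (g, h); split=> //.
  by rewrite -[RHS]run_psi -(@run_filter _ phi psi Z w true) ?addbF.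
rewrite (_ : map phi S = map psi S) //; apply/eq_in_map => x xS.
by rewrite /phi (negPf (SZ x xS)).
Qed.

Lemma pole_word_filter Z S w :
  {in S, forall x, ~~ Z x} -> pole_word S w -> pole_word S (filter (predC Z) w).
Proof.
move=> SZ [uS sS cS]; split=> // x; rewrite count_filter.
have [Zx | nZx] := boolP (Z x).
  rewrite (contraTF (SZ x) Zx) (_ : count _ _ = 0); first by left.
  rewrite (eq_count (a2 := pred0)) ?count_pred0 // => y /=.
  by case: eqVneq => // ->; rewrite Zx.
rewrite (_ : count _ w = count_mem x w); first exact: cS.
by apply: eq_count => y /=; case: eqVneq => // ->; rewrite nZx.
Qed.

Lemma arc_counts x y z a b c e :
    pole_word [:: x; y; z] (x :: a ++ y :: b ++ z :: c) ->
  [/\ e \in [:: x; y; z] -> count_mem e (a ++ b ++ c) = 0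
    & count_mem e (a ++ b ++ c) = 0 \/ count_mem e (a ++ b ++ c) = 2].
Proof.
case=> uS _ /(_ e).
have -> : count_mem e (x :: a ++ y :: b ++ z :: c) =
    count_mem e [:: x; y; z] + count_mem e (a ++ b ++ c).
  by rewrite /= !count_cat /= !count_cat /=; clear; lia.
rewrite count_uniq_mem //; case: (e \in _); first by clear; lia.
by rewrite add0n.
Qed.

Lemma word_cover_even_arcs x y z a b c :
    pole_word [:: x; y; z] (x :: a ++ y :: b ++ z :: c) ->
    ~~ odd (size a) -> ~~ odd (size b) -> ~~ odd (size c) ->
  word_cover [:: x; y; z] (x :: a ++ y :: b ++ z :: c).
Proof.
move=> pole_w /negPf even_a /negPf even_b /negPf even_c.
have [uS _ _] := pole_w.
move: (uS); rewrite /= !inE negb_or => /and3P[/andP[xy xz] yz _].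
pose phi e : color := if e == x then (true, false) else
  if e == y then (false, true) else if e == z then (true, true) else c0.
have [phi_x phi_y phi_z] : [/\ phi x = (true, false), phi y = (false, true)
                             & phi z = (true, true)].
  by rewrite /phi !eqxx !(eq_sym z) (eq_sym y) (negPf xy) (negPf xz) (negPf yz).
have phi0 : {in a ++ b ++ c, forall e, phi e = c0}.
  move=> e; rewrite -has_pred1 has_count /phi.
  have [S_e _] := arc_counts e pole_w; move: S_e; rewrite !inE.
  by do 3!case: (e == _) => [/(_ isT)->|] //.
have run0 g d : {subset d <= a ++ b ++ c} -> odd (size d) = false ->
    run phi d (g, true) = Some (g, true).
  by move=> dS even_d; rewrite run_zero ?even_d // => e /dS; apply: phi0.
(* The edge entering [x] gets the value of [y]; then the arcs [a], [b], [c] start with the values of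
   [z], [x], [y], each different from that of the next spoke. *)
exists phi, ((false, true), true); split=> //; last by rewrite /= phi_x phi_y phi_z.
rewrite /= phi_x /= run_cat run0 //=; last by move=> e ea; rewrite mem_cat ea.
rewrite phi_y /= run_cat run0 //=; last by move=> e eb; rewrite !mem_cat eb orbT.
by rewrite phi_z /= run0 // => e ec; rewrite !mem_cat ec !orbT.
Qed.

Lemma word_cover_exit x y z d (r : seq T) :
    pole_word [:: x; y; z] (x :: d ++ y :: r) -> z \notin d -> odd (size d) ->
    one_exit d ->
    (forall S w : seq T, size w < size (x :: d ++ y :: r) ->
      pole_word S w -> word_cover S w) ->
  word_cover [:: x; y; z] (x :: d ++ y :: r).
Proof.
move=> pole_w zd odd_d [t td d_in] IH.
apply: (word_cover_contract pole_w odd_d td d_in); apply: IH.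
  by rewrite /= size_cat /=; lia.
exact: pole_word_contract pole_w zd td d_in.
Qed.

Lemma word_cover_two_odd x y z a b c :
    pole_word [:: x; y; z] (x :: a ++ y :: b ++ z :: c) ->
    ~~ odd (size a) -> odd (size b) -> odd (size c) ->
    (forall S w : seq T, size w < size (x :: a ++ y :: b ++ z :: c) ->
      pole_word S w -> word_cover S w) ->
  word_cover [:: x; y; z] (x :: a ++ y :: b ++ z :: c).
Proof.
set w := x :: a ++ _ => pole_w even_a odd_b odd_c IH.
have counts e := arc_counts e pole_w.
have S_notin e : e \in [:: x; y; z] -> e \notin a ++ b ++ c.
  by case: (counts e) => S_e _ /S_e; rewrite -has_pred1 has_count => ->.
have [||||[Z [Zw Za Zb Zc]] | [b_exit | c_exit]] := @even_runs_or_one_exit _ a b c => //.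
- by move=> e; case: (counts e).
(* [Z] is only controlled on the arcs, so the spokes are removed from it explicitly. *)
- pose Z' := [pred e | Z e && (e \notin [:: x; y; z])].
  have SZ' : {in [:: x; y; z], forall e, ~~ Z' e} by move=> e /= ->; rewrite andbF.
  have Z'E d : {subset d <= a ++ b ++ c} -> even_runs Z true d -> even_runs Z' true d.
    move=> dS; rewrite (@eq_in_even_runs _ Z Z') // => e /dS.
    by apply: contraTeq; rewrite /= -negb_imply; case: (Z e) => //= /negPn/S_notin.
  have skip e d : e \in [:: x; y; z] -> even_runs Z' true d -> even_runs Z' true (e :: d).
    move=> /SZ'/negPf Z'e.
    suff -> : even_runs Z' true (e :: d) = even_runs Z' true d by [].
    by rewrite -[LHS]/(if Z' e then _ else even_runs Z' true d) Z'e.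
  apply: (word_cover_filter SZ').
    apply/skip/even_runs_cat; rewrite ?inE ?eqxx //.
      by apply: Z'E => // e ea; rewrite mem_cat ea.
    apply/skip/even_runs_cat; rewrite ?inE ?eqxx ?orbT //.
      by apply: Z'E => // e eb; rewrite !mem_cat eb orbT.
    apply/skip; first by rewrite !inE eqxx !orbT.
    by apply: Z'E => // e ec; rewrite !mem_cat ec !orbT.
  apply: IH; last exact: pole_word_filter.
  rewrite size_filter -(count_predC (predC Z') w) -addn1 leq_add2l -has_count.
  case/hasP: Zw => e e_w Ze; apply/hasP; exists e.
    by move: e_w; rewrite /w !(inE, mem_cat) => /or3P[] ->; rewrite ?orbT.
  by rewrite /= Ze /= negbK; apply: contraL e_w => /S_notin.
(* The word is rotated so that the arc with a single exit follows its first letter, as the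
   contraction expects. *)
- have rot_w : w = (x :: a) ++ (y :: b ++ z :: c) by [].
  have rot_S : perm_eq [:: y; z; x] [:: x; y; z] by rewrite (perm_catC [:: y; z]).
  apply: (word_cover_perm rot_S); rewrite rot_w; apply: word_cover_rot.
  rewrite -cat_cons -catA /=; apply: word_cover_exit => //.
  + apply: pole_word_perm pole_w; first by rewrite perm_sym.
    by rewrite rot_w perm_catC /= -catA.
  + by apply: contra (S_notin x (mem_head _ _)) => xb; rewrite !mem_cat xb orbT.
  by move=> S v ltvw; apply: IH; move: ltvw; rewrite /w /= !size_cat /= !size_cat /=; lia.
have rot_w : w = (x :: a ++ y :: b) ++ (z :: c) by rewrite /= -catA.
have rot_S : perm_eq [:: z; x; y] [:: x; y; z] by rewrite (perm_catC [:: z]).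
apply: (word_cover_perm rot_S); rewrite rot_w; apply: word_cover_rot.
rewrite cat_cons; apply: word_cover_exit => //.
- apply: pole_word_perm pole_w; first by rewrite perm_sym.
  by rewrite rot_w perm_catC.
- have: y \notin a ++ b ++ c by apply: S_notin; rewrite !inE eqxx orbT.
  by apply: contra => yc; rewrite !mem_cat yc !orbT.
by move=> S v ltvw; apply: IH; move: ltvw; rewrite /w /= !size_cat /= !size_cat /=; lia.
Qed.

(** Non-spoke letters occur an even number of times, so the number of odd arcs is zero or two; in
    the latter case a rotation brings the even arc to the front. *)
Lemma word_cover_arcs x y z a b c :
    pole_word [:: x; y; z] (x :: a ++ y :: b ++ z :: c) ->
    (forall S w : seq T, size w < size (x :: a ++ y :: b ++ z :: c) ->
      pole_word S w -> word_cover S w) ->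
  word_cover [:: x; y; z] (x :: a ++ y :: b ++ z :: c).
Proof.
set w := x :: a ++ _ => pole_w IH.
have: ~~ odd (size (a ++ b ++ c)).
  by apply: even_size_of_counts => e; case: (arc_counts e pole_w) => _ [] ->.
rewrite !size_cat !oddD.
have [odd_a | even_a] := boolP (odd (size a)); last first.
  have [odd_b | even_b] := boolP (odd (size b)) => /= [/negPn odd_c | even_c].
    exact: word_cover_two_odd.
  exact: word_cover_even_arcs.
have [odd_b | even_b] /= := boolP (odd (size b)); rewrite ?negbK => parity_c.
  have rot_w : w = (x :: a ++ y :: b) ++ (z :: c) by rewrite /= -catA.
  have rot_S : perm_eq [:: z; x; y] [:: x; y; z] by rewrite (perm_catC [:: z]).
  apply: (word_cover_perm rot_S); rewrite rot_w; apply: word_cover_rot.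
  apply: word_cover_two_odd => //.
    apply: pole_word_perm pole_w; first by rewrite perm_sym.
    by rewrite rot_w perm_catC.
  by move=> S v ltvw; apply: IH; move: ltvw; rewrite /w /= !size_cat /= !size_cat /=; lia.
have rot_w : w = (x :: a) ++ (y :: b ++ z :: c) by [].
have rot_S : perm_eq [:: y; z; x] [:: x; y; z] by rewrite (perm_catC [:: y; z]).
apply: (word_cover_perm rot_S); rewrite rot_w; apply: word_cover_rot.
rewrite cat_cons -catA; apply: word_cover_two_odd => //.
  apply: pole_word_perm pole_w; first by rewrite perm_sym.
  by rewrite rot_w perm_catC /= -catA.
by move=> S v ltvw; apply: IH; move: ltvw; rewrite /w /= !size_cat /= !size_cat /=; lia.
Qed.

Theorem pole_word_cover S w : pole_word S w -> word_cover S w.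
Proof.
have [k] := ubnP (size w); elim: k S w => // k IHk S w ltwk pole_w.
have [uS sS cS] := pole_w; case: S sS uS cS pole_w => [|x [|y [|z []]]] // _ uS cS pole_w.
have in_w e : e \in [:: x; y; z] -> e \in w.
  by move=> eS; have := cS e; rewrite eS -has_pred1 has_count => ->.
have /splitPr def_w : x \in w by rewrite in_w ?mem_head.
case: def_w ltwk pole_w in_w {cS} => u v ltwk pole_w in_w.
apply: word_cover_rot; rewrite cat_cons.
have {}pole_w : pole_word [:: x; y; z] (x :: v ++ u).
  by apply: pole_word_perm pole_w; rewrite // -cat_cons perm_catC.
have in_vu e : e \in [:: y; z] -> e \in v ++ u.
  move=> eS; have := in_w e; rewrite in_cons eS orbT => /(_ isT).
  rewrite !mem_cat !inE; case: eqP => [ex | _]; last by rewrite orbC.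
  by move: uS; rewrite /= -ex eS.
have {ltwk} IH (S w' : seq T) :
    size w' < size (x :: v ++ u) -> pole_word S w' -> word_cover S w'.
  move=> ltw; apply: IHk; apply: leq_trans ltw _.
  by move: ltwk; rewrite /= !size_cat /=; lia.
move: (v ++ u) {in_w} pole_w in_vu IH => r pole_w in_r IH.
have /splitPr def_r : y \in r by rewrite in_r ?mem_head.
have z_r : z \in r by rewrite in_r // !inE eqxx orbT.
case: def_r pole_w z_r IH {in_r} => a b pole_w z_r IH.
have zy : z != y by move: uS; rewrite /= !inE (eq_sym z); case: (y == z); rewrite /= ?andbF.
move: z_r; rewrite mem_cat inE (negPf zy) => /orP[/splitPr za | /splitPr zb].
  case: za pole_w IH => a1 a2; rewrite -catA cat_cons => pole_w IH.
  (* Here [z] comes before [y] on the circuit, so the two spokes exchange roles. *)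
  have rot_S : perm_eq [:: x; z; y] [:: x; y; z] by rewrite perm_cons (perm_catC [:: z]).
  apply: (word_cover_perm rot_S); apply: word_cover_arcs => //.
  by apply: pole_word_perm pole_w; first by rewrite perm_sym.
by case: zb pole_w IH => b1 b2 pole_w IH; apply: word_cover_arcs.
Qed.

End WordTheorem.

(** * The word of a Hamiltonian pole *)

Lemma run_states (T : eqType) (phi : T -> color) (w : seq T) s t :
    run phi w s = Some t ->
  exists st : nat -> state, [/\ st 0 = s, st (size w) = t
    & forall x0 i, i < size w -> step (phi (nth x0 w i)) (st i) = Some (st i.+1)].
Proof.
elim: w s => [|x w IHw] s /=; first by case=> <-; exists (fun=> s).
case step_s: (step _ s) => [s1|] //= /IHw[st [st0 stw stP]].
exists (fun i => if i is j.+1 then st j else s); split=> // x0 [|i] /=.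
  by rewrite st0.
exact: stP.
Qed.

Lemma step_neq0 c s t : step c s = Some t -> s.1 != c0 -> t.1 != c0.
Proof.
by rewrite /step; case: s => [[[] []] []]; case: c => [[] []] //= [<-].
Qed.

(** Membership of an edge of H with state [s] in the matching named by the nonzero color [k]. *)
Definition in_state (k : color) (s : state) := (k == s.1) == s.2.

(** This is the perfect matching condition at a vertex with chord value [c] and edges of H in states
    [s] and [t]. *)
Lemma in_state_step k c s t :
    k != c0 -> s.1 != c0 -> step c s = Some t ->
  in_state k s + in_state k t + (k == c) = 1.
Proof.
by rewrite /step; case: s => [[[] []] []]; case: c => [[] []] //= k0 _ [<-];
  case: k k0 => [[] []].
Qed.

Section HamiltonianPole.

Variables (G : multipole) (H : {set edge G}).
Hypothesis pole : hamiltonian_cubic3pole H.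

Let deg3 v : degree [set: edge G] v = 3. Proof. by case: pole => [[]]. Qed.
Let card_spokes : #|[set e : edge G | dangling e]| = 3.
Proof. by case: pole => [[]]. Qed.
Let spanning v : touches H v. Proof. by case: pole => [_ []]. Qed.
Let deg2 v : degree H v = 2.
Proof. by case: pole => [_ [[_ _ deg2 _] _]]; apply: deg2. Qed.
Let H_regular e : e \in H -> regular e.
Proof. by case: pole => [_ [[_ reg _ _] _]]; apply: reg. Qed.
Let H_connected u v : connect (adjacent H) u v.
Proof. by case: pole => [_ [[_ _ _ conn] _]]; apply: conn. Qed.

Lemma chord_at_exists v : exists e, edges_at (chords H) v = [set e].
Proof.
apply/cards1P; have := deg3 v; rewrite /degree -(cardsID H).
have -> : edges_at setT v :&: H = edges_at H v.
  by apply/setP => e; rewrite !inE andbC.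
have -> : edges_at setT v :\: H = edges_at (chords H) v.
  by apply/setP => e; rewrite !inE.
by rewrite -/(degree H v) deg2 => ?; lia.
Qed.

(** Edges of H seen from one end. Crossing an edge by [flip] and turning at the far end by [rho]
    moves one step along H. *)
Let dart := {d : vertex G * edge G | (d.2 \in H) && (d.1 \in ends d.2)}.
Let tail (d : dart) := (val d).1.
Let arc (d : dart) := (val d).2.

Lemma card_darts_at d : #|[set d' | tail d' == tail d]| = 2.
Proof.
rewrite -(deg2 (tail d)) /degree -(@card_in_imset _ _ arc).
  congr #|pred_of_set _|; apply/setP => e; rewrite !inE; apply/imsetP/andP.
    move=> [d' /[!inE]/eqP <- ->]; exact/andP/(valP d').
  move=> [eH ve]; have de : (e \in H) && (tail d \in ends e) by rewrite eH ve.
  by exists (Sub (tail d, e) de); rewrite ?inE /arc /tail SubK.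
move=> d1 d2 /[!inE]/eqP d1d /eqP d2d eq_arc; apply: val_inj.
apply: injective_projections; last exact: eq_arc.
by rewrite -/(tail d1) d1d.
Qed.

Lemma card_darts_on d : #|[set d' | arc d' == arc d]| = 2.
Proof.
have dH : arc d \in H by have /andP[] := valP d.
rewrite -(eqP (H_regular dH)) -(@card_in_imset _ _ tail).
  congr #|pred_of_set _|; apply/setP => v; apply/imsetP/idP.
    by move=> [d' /[!inE]/eqP <- ->]; have /andP[] := valP d'.
  move=> ve; have de : (arc d \in H) && (v \in ends (arc d)) by rewrite dH.
  by exists (Sub (v, arc d) de); rewrite ?inE /arc /tail SubK.
move=> d1 d2 /[!inE]/eqP d1d /eqP d2d eq_tail; apply: val_inj.
apply: injective_projections; first exact: eq_tail.
by rewrite -/(arc d1) d1d.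
Qed.

Let rho := partner tail.
Let flip := partner arc.
Let rhoK : involutive rho := partnerK card_darts_at.
Let flipK : involutive flip := partnerK card_darts_on.
Let rho_neq d : rho d != d := partner_neq card_darts_at d.
Let flip_neq d : flip d != d := partner_neq card_darts_on d.
Let next := rho \o flip.

Let K := alternating_component rho flip.

Lemma dart_at v e : e \in H -> v \in ends e -> exists d : dart, tail d = v /\ arc d = e.
Proof.
move=> eH ve; have de : (e \in H) && (v \in ends e) by rewrite eH.
by exists (Sub (v, e) de); rewrite /tail /arc SubK.
Qed.

(** The vertices met by the component are closed under adjacency in H, so connectedness of H makes
    them all the vertices. *)
Lemma all_darts_in_component d0 d : d \in K d0.
Proof.
have K_tail d1 d2 : tail d1 = tail d2 -> (d1 \in K d0) = (d2 \in K d0).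
  case/(fibre_partner card_darts_at) => -> //.
  exact: (alternating_component_s rhoK flipK d0 d2).
have K_arc d1 d2 : arc d1 = arc d2 -> (d1 \in K d0) = (d2 \in K d0).
  case/(fibre_partner card_darts_on) => -> //.
  exact: (alternating_component_t rho flipK d0 d2).
pose KV := [pred v | [exists d, (d \in K d0) && (tail d == v)]].
have KVE d1 : (tail d1 \in KV) = (d1 \in K d0).
  apply/existsP/idP => [[d2 /andP[Kd2 /eqP/K_tail <-]] // | Kd1].
  by exists d1; rewrite Kd1 eqxx.
have KV_closed : closed (adjacent H) KV.
  move=> u v /existsP[e /andP[eH /eqP ends_e]].
  have [||d1 [<- arc1]] := @dart_at u e; rewrite ?ends_e ?set21 //.
  have [||d2 [<- arc2]] := @dart_at v e; rewrite ?ends_e ?set22 //.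
  by rewrite !KVE; apply: K_arc; rewrite arc1 arc2.
rewrite -KVE -(closed_connect KV_closed (H_connected (tail d0) (tail d))) KVE.
by rewrite inE in_orbit.
Qed.

Section Tour.

Variable d0 : dart.
Let tour := orbit next d0.

Lemma tour_next d : (next d \in tour) = (d \in tour).
Proof. exact: (orbit_comp rhoK flipK d0 d). Qed.

(** The darts off the tour traverse H in the opposite direction. *)
Lemma tour_flip d : (flip d \in tour) = (d \notin tour).
Proof. exact: (orbit_comp_t rhoK flipK rho_neq flip_neq (all_darts_in_component d0)). Qed.

Lemma tour_rho d : (rho d \in tour) = (d \notin tour).
Proof. exact: (orbit_comp_s rhoK flipK rho_neq flip_neq (all_darts_in_component d0)). Qed.

Lemma tour_tail_inj : {in tour &, injective tail}.
Proof.
move=> d1 d2 d1_in d2_in /(fibre_partner card_darts_at)[] // d1E.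
by move: d1_in; rewrite d1E (tour_rho d2) d2_in.
Qed.

Lemma tour_arc_inj : {in tour &, injective arc}.
Proof.
move=> d1 d2 d1_in d2_in /(fibre_partner card_darts_on)[] // d1E.
by move: d1_in; rewrite d1E (tour_flip d2) d2_in.
Qed.

Lemma tour_tail v : exists2 d, d \in tour & tail d = v.
Proof.
have /existsP[e /andP[eH /(dart_at eH)[d [<- _]]]] := spanning v.
have [d_in | d_out] := boolP (d \in tour); first by exists d.
by exists (rho d); [rewrite tour_rho | apply: (partner_fibre card_darts_at)].
Qed.

Lemma tour_arc e : e \in H -> exists2 d, d \in tour & arc d = e.
Proof.
move=> eH; have /card_gt0P[v ve] : 0 < #|ends e| by rewrite (eqP (H_regular eH)).
have [d [_ <-]] := dart_at eH ve.
have [d_in | d_out] := boolP (d \in tour); first by exists d.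
by exists (flip d); [rewrite tour_flip | apply: (partner_fibre card_darts_on)].
Qed.

Variable q : vertex G -> edge G.
Hypothesis qP : forall v, edges_at (chords H) v = [set q v].

Let spokes := enum [set e : edge G | dangling e].
Let word := [seq q (tail d) | d <- tour].

(** The tour visits each vertex once, so a chord occurs once for each of its ends, and edges of H
    never occur. *)
Lemma pole_word_tour : pole_word spokes word.
Proof.
split; [exact: enum_uniq | by rewrite -cardE | move=> e].
have tails_perm : perm_eq (map tail tour) (enum (vertex G)).
  apply: uniq_perm; rewrite ?enum_uniq ?(map_inj_in_uniq tour_tail_inj) ?orbit_uniq //.
  move=> v; rewrite mem_enum; apply/mapP.
  by have [d d_in <-] := tour_tail v; exists d.
have -> : count_mem e word = #|[set v | q v == e]|.
  rewrite /word (map_comp q tail) count_map (permP tails_perm) cardE -size_filter.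
  by rewrite /enum_mem -filter_predI; congr size; apply: eq_filter => v; rewrite !inE andbT.
rewrite mem_enum inE; have [eH | eQ] := boolP (e \in H).
  have -> : dangling e = false by rewrite /dangling (eqP (H_regular eH)).
  left; apply/eqP; rewrite cards_eq0; apply/eqP/setP => v; rewrite !inE.
  apply: contraTF eH => /eqP <-.
  by have := set11 (q v); rewrite -qP !inE => /andP[].
have -> : [set v | q v == e] = ends e.
  apply/setP => v; rewrite inE eq_sym -in_set1 -qP !inE eQ //.
have := ends_card e; rewrite /dangling.
by case: eqP => //= _ /eqP; right.
Qed.

Lemma tour_states : exists phi st,
  [/\ forall e, e \in H -> (st e).1 != c0,
      forall v, exists h h', [/\ h != h', edges_at H v = [set h; h']
                              & step (phi (q v)) (st h) = Some (st h')]
    & uniq (c0 :: map phi spokes)].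
Proof.
have [phi [s [s0 /run_states[st [st_0 st_n stP]] uphi]]] := pole_word_cover pole_word_tour.
pose pos e := index e (map arc tour).
have size_word : size word = size tour by rewrite size_map.
have st_neq0 i : i <= size word -> (st i).1 != c0.
  elim: i => [|i IHi] i_n; first by rewrite st_0.
  exact: step_neq0 (stP (q (tail d0)) i i_n) (IHi (ltnW i_n)).
have pos_arc d : d \in tour -> pos (arc d) = index d tour.
  move=> d_in; rewrite /pos -{1}(nth_index d0 d_in) -(nth_map d0 (arc d0)) ?index_mem //.
  rewrite index_uniq ?size_map ?index_mem //.
  by rewrite (map_inj_in_uniq tour_arc_inj) orbit_uniq.
have step_next d : d \in tour ->
    step (phi (q (tail (next d)))) (st (pos (arc d)).+1)
      = Some (st (pos (arc (next d))).+1).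
  move=> d_in; rewrite !pos_arc ?tour_next //.
  set i := index d tour; have i_n : i < size tour by rewrite index_mem.
  have tour_gt0 : 0 < size tour by apply: leq_ltn_trans i_n.
  have iterE j : j < size tour -> nth d0 tour j = iter j next d0.
    by rewrite size_orbit => j_n; rewrite /tour /orbit nth_traject.
  have d_i : iter i next d0 = d by rewrite -iterE // nth_index.
  have letterE j : j < size tour -> nth (q (tail d0)) word j = q (tail (iter j next d0)).
    by move=> j_n; rewrite (nth_map d0) // iterE.
  have next_i : iter i.+1 next d0 = next d by rewrite iterS d_i.
  have [i1_n | n_i1] := ltnP i.+1 (size tour).
    have -> : index (next d) tour = i.+1.
      by rewrite -next_i -iterE // index_uniq ?orbit_uniq.
    by rewrite -next_i -letterE // stP // size_word.
  (* At the end of the tour the step wraps around to [d0], which works because the final state of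
     the run is its initial state. *)
  have i1 : i.+1 = size tour by apply/eqP; rewrite eqn_leq i_n.
  have next_d : next d = d0.
    rewrite -next_i i1 size_orbit iter_order //.
    exact: comp_involutions_inj rhoK flipK.
  have -> : index (next d) tour = 0.
    by rewrite next_d -(iterE 0 tour_gt0 : _ = d0) index_uniq ?orbit_uniq.
  rewrite next_d -(letterE 0 tour_gt0 : _ = q (tail d0)).
  by rewrite i1 -size_word st_n -st_0 stP // size_word.
(* An arc leaves the tail of its dart, so it carries the state after the letter of that dart, hence
   the successor. *)
exists phi, (fun e => st (pos e).+1); split=> //.
  move=> e eH; apply: st_neq0; rewrite size_word -(size_map arc) index_mem.
  by have [d d_in <-] := tour_arc eH; apply: map_f.
move=> v; have [d d_in <-] := tour_tail v.
have arcs_neq : arc (rho d) != arc d.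
  apply: contra (rho_neq d) => /eqP eq_arc; apply/eqP/val_inj.
  apply: injective_projections => //; exact: (partner_fibre card_darts_at d).
exists (arc (rho d)), (arc d); split=> //.
  apply/esym/eqP; rewrite eqEcard -/(degree H _) deg2 cards2 arcs_neq andbT.
  apply/subsetP => e /set2P[] ->; rewrite inE.
    by rewrite -(partner_fibre card_darts_at d); apply: (valP (rho d)).
  exact: (valP d).
(* [flip (rho d)] is the dart just before [d] on the tour, and it lies on the other edge of H at
   [v]. *)
have := @step_next (flip (rho d)); rewrite /next /= flipK rhoK.
rewrite (partner_fibre card_darts_on (rho d)); apply.
by rewrite tour_flip tour_rho negbK.
Qed.

End Tour.

(** * The four matchings read off from the states *)

Lemma proper_4cover_exists : exists M : 'I_4 -> {set edge G}, proper_4cover H M.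
Proof.
have [q qP] := fin_all_exists chord_at_exists.
have [e0 e0H] : exists e, e \in H.
  by apply/set0Pn; case: pole => [_ [[]]].
have /card_gt0P[v0 v0e] : 0 < #|ends e0| by rewrite (eqP (H_regular e0H)).
have [d0 _] := dart_at e0H v0e.
have [phi [st [st_neq0 st_v uphi]]] := tour_states d0 qP.
(* The first three matchings are named by the nonzero colors; [ord_max] falls on the default
   [c0]. *)
pose kappa (i : 'I_4) : color := nth c0 [:: (true, false); (false, true); (true, true)] i.
pose M (i : 'I_4) := [set e | if e \in H then (i != ord_max) && in_state (kappa i) (st e)
                              else (i == ord_max) || (kappa i == phi e)].
have kappa_neq0 i : i != ord_max -> kappa i != c0 by case: i => [[|[|[|[|]]]]].
have kappa_inj i j : i != ord_max -> kappa i = kappa j -> i = j.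
  by case: i => -[|[|[|[|//]]]] ?; case: j => -[|[|[|[|//]]]] ? //= _ _; apply: val_inj.
have kappa_surj k : k != c0 -> exists2 i, i != ord_max & kappa i = k.
  case: k => [[] []] // _; [exists (inord 2) | exists (inord 0) | exists (inord 1)];
    by rewrite ?/kappa -?val_eqE /= inordK.
have other_color k : exists2 c : color, c != c0 & c != k.
  by case: k => [[] []]; [exists (true, false) | exists (true, true) | exists (true, true)
    | exists (true, true)].
have spokeQ e : dangling e -> e \notin H.
  by rewrite /dangling; apply: contraTN => /H_regular/eqP ->.
have phi_spoke c : c != c0 -> exists2 e, dangling e & phi e = c.
  move=> c_neq0; have [/mapP[e] | c_out] := boolP (c \in map phi (enum [set e | dangling e])).
    by rewrite mem_enum inE; exists e.
  (* A nonzero color missing on the spokes would give five distinct colors, but there are only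
     four. *)
  have: uniq (c :: c0 :: map phi (enum [set e | dangling e])).
    by rewrite cons_uniq in_cons negb_or c_neq0 c_out.
  move/card_uniqP => card5.
  have := max_card (mem (c :: c0 :: map phi (enum [set e | dangling e]))).
  by rewrite card5 /= size_map -cardE card_spokes card_prod card_bool.
have M_spoke i e : dangling e -> (e \in M i) = (i == ord_max) || (kappa i == phi e).
  by move=> /spokeQ/negPf eQ; rewrite inE eQ.
(* A spoke whose value differs from [kappa i] lies in the last matching and not in [M i]. *)
have M_max i : i != ord_max -> M i != M ord_max.
  move=> i_max; have [c c0_neq c_k] := other_color (kappa i).
  have [e de phi_e] := phi_spoke c c0_neq; apply/eqP => /setP/(_ e).
  by rewrite !M_spoke // eqxx (negPf i_max) phi_e eq_sym (negPf c_k).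
exists M; split.
- move=> i j eqM; have [i_max | i_max] := eqVneq i ord_max.
    by apply/eqP; rewrite i_max eq_sym; apply: contraT => /M_max; rewrite -eqM i_max eqxx.
  have [j_max | j_max] := eqVneq j ord_max.
    by have := M_max i i_max; rewrite eqM j_max eqxx.
  have [e de phi_e] := phi_spoke (kappa i) (kappa_neq0 i i_max).
  move/setP/(_ e): eqM; rewrite !M_spoke // phi_e eqxx orbT (negPf j_max) /=.
  by move/esym/eqP/esym/kappa_inj; apply.
- move=> i v; have [h [h' [h_neq Hv st_h]]] := st_v v.
  have [hH h'H] : h \in H /\ h' \in H.
    have := set21 h h'; have := set22 h h'; rewrite -Hv !inE.
    by move=> /andP[-> _] /andP[-> _].
  have qQ : q v \notin H.
    by have := set11 (q v); rewrite -qP !inE => /andP[].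
  have -> : degree (M i) v = (h \in M i) + (h' \in M i) + (q v \in M i).
    have vE : edges_at (M i) v = [set e in [set q v; h; h'] | e \in M i].
      have -> : [set q v; h; h'] = edges_at setT v.
        apply/setP => e; rewrite !inE -orbA -in_set1 -qP -in_set2 -Hv !inE.
        by case: (e \in H); rewrite ?andbT ?andbF ?orbF.
      by apply/setP => e; rewrite !inE andbC.
    rewrite /degree vE -sum1_card.
    transitivity (\sum_(e in [set q v; h; h']) (e \in M i : nat)).
      rewrite big_mkcond [RHS]big_mkcond; apply: eq_bigr => e _; rewrite inE.
      by do 2!case: (e \in _).
    have q_neq x : x \in H -> (q v == x) = false.
      by move=> xH; apply: contraNF qQ => /eqP ->.
    rewrite -setUA big_setU1 ?big_setU1 ?big_set1 ?inE ?q_neq ?h_neq //=.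
    by rewrite addnC.
  rewrite !inE hH h'H (negPf qQ); have [//|i_neq] := eqVneq i ord_max.
  by rewrite /= (in_state_step (kappa_neq0 i i_neq) _ st_h) ?st_neq0.
- move=> e; have [eH | eQ] := boolP (e \in H); last first.
    by exists ord_max; rewrite inE (negPf eQ) eqxx.
  have [k k_neq0 in_k] : exists2 k, k != c0 & in_state k (st e).
    rewrite /in_state; case: (st e) (st_neq0 e eH) => g [] /= g_neq0.
      by exists g; rewrite ?eqxx.
    by have [k k_neq0 k_g] := other_color g; exists k; rewrite // (negPf k_g).
  have [i i_max kappa_i] := kappa_surj k k_neq0.
  by exists i; rewrite inE eH i_max kappa_i.
- by apply/setP => e; rewrite !inE eqxx; case: (e \in H).
move=> e de; have phi_e : phi e != c0.
  move: uphi; rewrite cons_uniq => /andP[c0_out _]; apply: contraNneq c0_out => <-.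
  by apply: map_f; rewrite mem_enum inE.
have [i i_max kappa_i] := kappa_surj _ phi_e.
have -> : [set j | e \in M j] = [set ord_max; i].
  apply/setP => j; rewrite in_set M_spoke // !inE -kappa_i.
  have [// | j_max] := eqVneq j ord_max.
  by apply/eqP/eqP => [/kappa_inj-> // | ->].
by rewrite cards2 eq_sym i_max.
Qed.

End HamiltonianPole.

Theorem theorem3p1 (G : multipole) (H : {set edge G}) :
  hamiltonian_cubic3pole H ->
  exists M : 'I_4 -> {set edge G}, proper_4cover H M.
Proof. exact: proper_4cover_exists. Qed.
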